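(* Let $R$ be an associative unital, but not necessarily commutative, ring and let $E=(E^0,E^1,r,s)$ be a directed graph. Consider the Leavitt path algebra $L_R(E)$ with its canonical $\mathbb{Z}$-gradation. The following three assertions are equivalent: (i) $L_R(E)$ is strongly $\mathbb{Z}$-graded; (ii) $E$ is row-finite, has no sink, and satisfies Condition (Y); (iii) $E$ is row-finite, has no sink, and satisfies Condition (Y1).
   Context: Here $\mathbb{N}=\{1,2,3,\ldots\}$. Graphs. A directed graph $E=(E^0,E^1,r,s)$ consists of a set $E^0$ of vertices, a set $E^1$ of edges, and maps $r,s:E^1\to E^0$ (range and source). A sink is a vertex $v$ with $s^{-1}(v)=\varnothing$. $E$ is row-finite if $s^{-1}(v)$ is a finite set for every $v\in E^0$. A finite path of length $n\geq 1$ is a sequence of edges $\mu=\mu_1\cdots\mu_n$ with $r(\mu_i)=s(\mu_{i+1})$ for $1\le i\le n-1$; one puts $s(\mu)=s(\mu_1)$, $r(\mu)=r(\mu_n)$, $|\mu|=n$. Each vertex $v$ is regarded as a finite path of length $0$ with $s(v)=r(v)=v$. $E^*$ denotes the set of all finite paths (including vertices). An infinite path is a sequence $p=\mu_1\mu_2\mu_3\cdots$ of edges with $r(\mu_i)=s(\mu_{i+1})$ for all $i\in\mathbb{N}$. A finite path $\alpha\in E^*$ is an initial subpath of an infinite path $p$ if $p=\alpha p'$ for some infinite path $p'$ (the vertex $s(p)$ being the initial subpath of length $0$). Condition (Y): for every $k\in\mathbb{N}$ and every infinite path $p$, there exist an initial subpath $\alpha$ of $p$ and a finite path $\beta$ such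 that $r(\beta)=r(\alpha)$ and $|\beta|-|\alpha|=k$. Condition (Y1): for every infinite path $p$, there exist an initial subpath $\alpha$ of $p$ and a finite path $\beta$ such that $r(\beta)=r(\alpha)$ and $|\beta|-|\alpha|=1$. Leavitt path algebra. $L_R(E)$ is the (associative, not necessarily unital) algebra with coefficients in $R$ generated by the sets $\{v\mid v\in E^0\}$, $\{f\mid f\in E^1\}$ and $\{f^*\mid f\in E^1\}$, where $R$ commutes with the generators, subject to the relations: (1) $uv=\delta_{u,v}v$ for all $u,v\in E^0$; (2) $s(f)f=fr(f)=f$ and $r(f)f^*=f^*s(f)=f^*$ for all $f\in E^1$; (3) $f^*f'=\delta_{f,f'}r(f)$ for all $f,f'\in E^1$; (4) $\sum_{f\in E^1,\,s(f)=v}ff^*=v$ for every $v\in E^0$ for which $s^{-1}(v)$ is non-empty and finite. Gradation. The canonical $\mathbb{Z}$-gradation on $L_R(E)$ is the one induced by $\deg(v)=0$ for $v\in E^0$, and $\deg(f)=1$, $\deg(f^* )=-1$ for $f\in E^1$ (elements of $R$ having degree $0$): it is a gradation on the free algebra on these generators, the ideal generated by relations (1)--(4) is homogeneous, and so it passes to the quotient $L_R(E)$. An associative ring $S$ is $\mathbb{Z}$-graded if there are additive subgroups $S_n$ ($n\in\mathbb{Z}$) with $S=\bigoplus_{n\in\mathbb{Z}}S_n$ and $S_nS_m\subseteq S_{n+m}$ for all $n,m\in\mathbb{Z}$; it is strongly $\mathbb{Z}$-graded if moreover $S_nS_m=S_{n+m}$ for all $n,m\in\mathbb{Z}$. Here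 $S_nS_m$ denotes the set of all finite sums of products $ab$ with $a\in S_n$, $b\in S_m$. *)

(* Defs.v *)
From HB Require Import structures.
From mathcomp Require Import all_boot all_order all_algebra.
From mathcomp Require Import finmap monalg.
From mathcomp Require Import boolp classical_sets functions cardinality fsbigop.

Set Implicit Arguments.
Unset Strict Implicit.
Unset Printing Implicit Defensive.

Import GRing.Theory.

Local Open Scope classical_set_scope.
Local Open Scope ring_scope.

(** * Associative rings, not necessarily unital, and their gradations *)

HB.mixin Record Zmodule_isNonUnitalRing S of GRing.Zmodule S := {
  numul : S -> S -> S;
  numulA : associative numul;
  numulDl : left_distributive numul +%R;
  numulDr : right_distributive numul +%R;
}.

#[short(type="nonUnitalRingType")]
HB.structure Definition NonUnitalRing :=
  { S of Zmodule_isNonUnitalRing S & GRing.Zmodule S }.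

Section Gradations.
Variable S : nonUnitalRingType.

(* The set A B of all finite sums of products a b with a in A and b in B. *)
Definition setprod_sums (A B : set S) : set S :=
  [set x | exists2 ab : seq (S * S),
     (forall p, p \in ab -> A p.1 /\ B p.2) & x = \sum_(p <- ab) numul p.1 p.2].

Definition additive_subgroup (A : set S) : Prop :=
  A 0 /\ forall x y, A x -> A y -> A (x - y).

(* The finiteness condition matters: the sum over an infinite support is 0 by
   convention. *)
Definition direct_sum_decomposition (G : int -> set S) : Prop :=
  forall x, exists! c : int -> S,
    [/\ forall n, G n (c n),
        finite_set [set n | c n != 0]
      & x = \sum_(n \in [set: int]) c n].

Definition graded (G : int -> set S) : Prop :=
  [/\ forall n, additive_subgroup (G n),
      direct_sum_decomposition G
    & forall n m, setprod_sums (G n) (G m) `<=` G (n + m)].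

Definition strongly_graded (G : int -> set S) : Prop :=
  graded G /\ forall n m, setprod_sums (G n) (G m) = G (n + m).

End Gradations.

(** * Directed graphs *)

Record digraph := Digraph {
  vertex : Type;
  edge : Type;
  src : edge -> vertex;
  tgt : edge -> vertex
}.

HB.instance Definition _ (E : digraph) := gen_eqMixin (vertex E).
HB.instance Definition _ (E : digraph) := gen_choiceMixin (vertex E).
HB.instance Definition _ (E : digraph) := gen_eqMixin (edge E).
HB.instance Definition _ (E : digraph) := gen_choiceMixin (edge E).

Section Graphs.
Variable E : digraph.

Definition out_edges (v : vertex E) : set (edge E) := [set e | src e = v].

Definition row_finite : Prop := forall v, finite_set (out_edges v).

Definition is_sink (v : vertex E) : Prop := out_edges v = set0.

Fixpoint chain (v : vertex E) (es : seq (edge E)) : Prop :=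
  if es is e :: es' then src e = v /\ chain (tgt e) es' else True.

(* A path of length 0 is a vertex [v], encoded by [fpath_src = v] and no edges;
   for a path of positive length [chain] forces [fpath_src] to be the source of
   the first edge. *)
Record fpath := FPath {
  fpath_src : vertex E;
  fpath_edges : seq (edge E);
  fpathP : chain fpath_src fpath_edges
}.

Definition fpath_tgt (a : fpath) : vertex E :=
  last (fpath_src a) (map (@tgt E) (fpath_edges a)).

Definition fpath_len (a : fpath) : nat := size (fpath_edges a).

Record ipath := IPath {
  ipath_edge :> nat -> edge E;
  ipathP : forall i, tgt (ipath_edge i) = src (ipath_edge i.+1)
}.

Definition icat (es : seq (edge E)) (q : nat -> edge E) : nat -> edge E :=
  foldr (fun e q' i => if i is j.+1 then q' j else e) q es.

Definition initial_subpath (a : fpath) (p : ipath) : Prop :=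
  exists2 q : ipath, fpath_tgt a = src (q 0%N) & p =1 icat (fpath_edges a) q.

Definition condition_Y_at (k : nat) : Prop :=
  forall p : ipath, exists a b : fpath,
    [/\ initial_subpath a p, fpath_tgt b = fpath_tgt a
      & (fpath_len b)%:Z - (fpath_len a)%:Z = k%:Z].

Definition condition_Y : Prop := forall k : nat, (0 < k)%N -> condition_Y_at k.

Definition condition_Y1 : Prop := condition_Y_at 1.

End Graphs.

(** * Leavitt path algebras *)

Inductive lpa_gen (E : digraph) : Type :=
  | GVertex of vertex E
  | GEdge of edge E
  | GGhost of edge E.

HB.instance Definition _ (E : digraph) := gen_eqMixin (lpa_gen E).
HB.instance Definition _ (E : digraph) := gen_choiceMixin (lpa_gen E).

Section FreeAlgebra.
Variables (R : nzRingType) (E : digraph).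

(* The monoid algebra over R of the free monoid of words in the generators: the
   coefficients commute with the words, but not with each other. *)
Definition free_ualg := {malg R[{fmonom (lpa_gen E)}]}.

Definition gen (x : lpa_gen E) : free_ualg := << fmu x >>.

(* The free non-unital algebra: no constant term, i.e. combinations of words of
   positive length. *)
Definition no_const : {pred free_ualg} :=
  fun x => x@_(mone : {fmonom (lpa_gen E)}) == 0.

Fact no_const_zmod_closed : zmod_closed no_const.
Proof.
split=> [|x y]; rewrite !unfold_in ?mcoeff0 // => /eqP x0 /eqP y0.
by rewrite mcoeffB x0 y0 subrr.
Qed.

HB.instance Definition _ :=
  GRing.isZmodClosed.Build free_ualg no_const no_const_zmod_closed.

Record free_alg := FreeAlg {
  free_alg_val :> free_ualg;
  free_algP : free_alg_val \in no_const
}.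

HB.instance Definition _ := [isSub for free_alg_val].
HB.instance Definition _ := [Choice of free_alg by <:].
HB.instance Definition _ := [SubChoice_isSubZmodule of free_alg by <:].

Fact free_mul_subproof (x y : free_alg) :
  (x : free_ualg) * (y : free_ualg) \in no_const.
Proof.
rewrite unfold_in rmorphM /=.
by have /eqP-> := free_algP x; rewrite mul0r.
Qed.

Definition free_mul (x y : free_alg) : free_alg :=
  FreeAlg (free_mul_subproof x y).

Fact free_mulA : associative free_mul.
Proof. by move=> x y z; apply: val_inj; rewrite /= mulrA. Qed.

Fact free_mulDl : left_distributive free_mul +%R.
Proof. by move=> x y z; apply: val_inj; rewrite /= mulrDl. Qed.

Fact free_mulDr : right_distributive free_mul +%R.
Proof. by move=> x y z; apply: val_inj; rewrite /= mulrDr. Qed.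

HB.instance Definition _ :=
  Zmodule_isNonUnitalRing.Build free_alg free_mulA free_mulDl free_mulDr.

End FreeAlgebra.

Section Leavitt.
Variables (R : nzRingType) (E : digraph).
Local Notation V v := (gen R (GVertex v)).
Local Notation X e := (gen R (GEdge e)).
Local Notation X' e := (gen R (GGhost e)).

(* [lpa_relator x] is the relation x = 0. *)
Inductive lpa_relator : free_ualg R E -> Prop :=
  | rel_vertex u v : lpa_relator (V u * V v - V v *+ (u == v))
  | rel_src e : lpa_relator (V (src e) * X e - X e)
  | rel_tgt e : lpa_relator (X e * V (tgt e) - X e)
  | rel_ghost_tgt e : lpa_relator (V (tgt e) * X' e - X' e)
  | rel_ghost_src e : lpa_relator (X' e * V (src e) - X' e)
  | rel_CK1 e f : lpa_relator (X' e * X f - V (tgt e) *+ (e == f))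
  | rel_CK2 v of out_edges v !=set0 & finite_set (out_edges v) :
      lpa_relator (\sum_(e \in out_edges v) (X e * X' e) - V v).

(* The two-sided ideal generated by the relators.  They have no constant term,
   so it is contained in the free non-unital algebra, and it is the smallest
   ideal of the latter that contains them and is stable under the scalars. *)
Inductive lpa_ideal : free_ualg R E -> Prop :=
  | ideal_relator x of lpa_relator x : lpa_ideal x
  | ideal0 : lpa_ideal 0
  | idealB x y of lpa_ideal x & lpa_ideal y : lpa_ideal (x - y)
  | idealMl a x of lpa_ideal x : lpa_ideal (a * x)
  | idealMr x a of lpa_ideal x : lpa_ideal (x * a).

Definition lpa_ideal_pred : {pred free_alg R E} := fun x => `[< lpa_ideal x >].

Fact lpa_ideal_zmod_closed : zmod_closed lpa_ideal_pred.
Proof.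
split=> [|x y]; first by apply/asboolP; exact: ideal0.
by move=> /asboolP Ix /asboolP Iy; apply/asboolP; exact: idealB.
Qed.

HB.instance Definition _ :=
  GRing.isZmodClosed.Build (free_alg R E) lpa_ideal_pred lpa_ideal_zmod_closed.

(* R is nontrivial by its type: over the zero ring this is the zero ring, which
   is strongly graded whatever E is. *)
Definition lpa := Quotient.quot lpa_ideal_pred.

HB.instance Definition _ := GRing.Zmodule.on lpa.

Definition lpa_pi (x : free_alg R E) : lpa := \pi_lpa%qT x.

Fact lpa_piP (x y : free_alg R E) :
  reflect (lpa_pi x = lpa_pi y) (x - y \in lpa_ideal_pred).
Proof. by rewrite Quotient.idealrBE; exact: eqP. Qed.

Fact lpa_piD : {morph lpa_pi : x y / x + y}.
Proof. by move=> x y; rewrite /lpa_pi raddfD. Qed.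

Definition lpa_mul (x y : lpa) : lpa := lpa_pi (numul (repr x) (repr y)).

Fact lpa_piM : {morph lpa_pi : x y / numul x y >-> lpa_mul x y}.
Proof.
move=> x y; apply/lpa_piP.
have Irepr (z : free_alg R E) : lpa_ideal (val z - val (repr (lpa_pi z))).
  apply/asboolP; rewrite -[_ - _]/(val (z - _)); apply/lpa_piP.
  by rewrite /lpa_pi reprK.
apply/asboolP; rewrite /=.
set x' := repr _; set y' := repr _.
have -> : val x * val y - val x' * val y' =
    (val x - val x') * val y - (val x' * - (val y - val y')) :> free_ualg R E.
  by rewrite mulrN opprK mulrBl mulrBr addrA subrK.
apply: idealB; first exact: idealMr.
by apply: idealMl; rewrite -sub0r; apply: idealB; [exact: ideal0 | exact: Irepr].
Qed.

Fact lpa_mulA : associative lpa_mul.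
Proof.
move=> x y z; rewrite -[x]reprK -[y]reprK -[z]reprK -!/(lpa_pi _).
by rewrite -!lpa_piM numulA.
Qed.

Fact lpa_mulDl : left_distributive lpa_mul +%R.
Proof.
move=> x y z; rewrite -[x]reprK -[y]reprK -[z]reprK -!/(lpa_pi _).
by rewrite -lpa_piD -!lpa_piM numulDl lpa_piD.
Qed.

Fact lpa_mulDr : right_distributive lpa_mul +%R.
Proof.
move=> x y z; rewrite -[x]reprK -[y]reprK -[z]reprK -!/(lpa_pi _).
by rewrite -lpa_piD -!lpa_piM numulDr lpa_piD.
Qed.

HB.instance Definition _ :=
  Zmodule_isNonUnitalRing.Build lpa lpa_mulA lpa_mulDl lpa_mulDr.

Definition gen_deg (x : lpa_gen E) : int :=
  match x with GVertex _ => 0 | GEdge _ => 1 | GGhost _ => -1 end.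

Definition word_deg (w : {fmonom (lpa_gen E)}) : int :=
  \sum_(x <- (w : seq (lpa_gen E))) gen_deg x.

Definition free_component (n : int) : set (free_alg R E) :=
  [set x | forall w : {fmonom (lpa_gen E)}, w \in msupp (val x) -> word_deg w = n].

Definition lpa_component (n : int) : set lpa := lpa_pi @` free_component n.

End Leavitt.

(* Main.v *)
From HB Require Import structures.
From mathcomp Require Import all_boot all_order all_algebra.
From mathcomp Require Import finmap monalg.
From mathcomp Require Import boolp classical_sets functions cardinality fsbigop.
Require Import Defs.

(* Write S for L_R(E).

   Sufficiency of (Y1).  It is enough that every vertex v lies in S_1 S_(-1) and
   in S_(-1) S_1.  The first is the Cuntz-Krieger relation v = sum of e e^*.  If
   the second fails, the same relation yields an infinite path from v whose
   vertex after n edges is never in S_(-n-1) S_(n+1); but if b is a path of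
   length n+1 ending at u, then u = b^* b is in S_(-n-1) S_(n+1).

   Necessity.  S acts on the free R-module over a set of boundary paths, each
   word acting by a partial injection.  If v is in S_(-m) S_m, then some word of
   degree m does not annihilate a given boundary path starting at v.  For a sink
   or an infinite emitter v, use the finite paths ending at v: a word of degree
   -1 annihilates the path of length 0.  For (Y), use the infinite paths: a word
   of degree k that does not annihilate p replaces an initial subpath of p by a
   path with the same range that is k longer. *)

Set Implicit Arguments.
Unset Strict Implicit.
Unset Printing Implicit Defensive.

Import GRing.Theory.

Local Open Scope classical_set_scope.
Local Open Scope ring_scope.

(** * Non-unital graded rings *)

Section NonUnitalRingTheory.
Variable S : nonUnitalRingType.
Implicit Types (A B C D : set S) (x y : S).

Lemma numul0r x : numul 0 x = 0.
Proof. by apply: (addrI (numul 0 x)); rewrite -numulDl !addr0. Qed.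

Lemma numulr0 x : numul x 0 = 0.
Proof. by apply: (addrI (numul x 0)); rewrite -numulDr !addr0. Qed.

Lemma setprod_sums0 A B : setprod_sums A B 0.
Proof. by exists [::]; rewrite ?big_nil. Qed.

Lemma setprod_sumsD A B x y :
  setprod_sums A B x -> setprod_sums A B y -> setprod_sums A B (x + y).
Proof.
move=> [s sAB ->] [t tAB ->]; exists (s ++ t); last by rewrite big_cat.
by move=> p; rewrite mem_cat => /orP[/sAB|/tAB].
Qed.

Lemma setprod_sumsM A B x y : A x -> B y -> setprod_sums A B (numul x y).
Proof.
move=> Ax By; exists [:: (x, y)]; last by rewrite big_seq1.
by move=> p; rewrite inE => /eqP->.
Qed.

Lemma setprod_sums_sum A B (I : eqType) (r : seq I) (F : I -> S) :
  (forall i, i \in r -> setprod_sums A B (F i)) ->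
  setprod_sums A B (\sum_(i <- r) F i).
Proof.
move=> AB; rewrite big_seq; elim/big_ind: _ => //; first exact: setprod_sums0.
by move=> x y; exact: setprod_sumsD.
Qed.

Lemma setprod_sums_mulr A B C x y : (forall b, B b -> C (numul b y)) ->
  setprod_sums A B x -> setprod_sums A C (numul x y).
Proof.
move=> BC [s sAB ->]; have -> : numul (\sum_(p <- s) numul p.1 p.2) y =
    \sum_(p <- s) numul (numul p.1 p.2) y.
  exact: (big_morph _ (fun a b => numulDl a b y) (numul0r y)).
apply: setprod_sums_sum => p /sAB[Ap Bp]; rewrite -numulA.
by apply: setprod_sumsM => //; exact: BC.
Qed.

Lemma setprod_sums_mull A B C x y : (forall a, A a -> C (numul y a)) ->
  setprod_sums A B x -> setprod_sums C B (numul y x).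
Proof.
move=> AC [s sAB ->]; have -> : numul y (\sum_(p <- s) numul p.1 p.2) =
    \sum_(p <- s) numul y (numul p.1 p.2).
  exact: (big_morph _ (fun a b => numulDr y a b) (numulr0 y)).
apply: setprod_sums_sum => p /sAB[Ap Bp]; rewrite numulA.
by apply: setprod_sumsM => //; exact: AC.
Qed.

(** The family of the [p n x] is a decomposition of [x]; it is the only one because [p n], applied
    to a finite sum of [c m] in [G m], kills every term but [c n]. *)
Lemma direct_sum_decomposition_proj (G : int -> set S)
    (p : int -> {additive S -> S}) :
  (forall n x, G n (p n x)) -> (forall n x, G n x -> p n x = x) ->
  (forall n m x, n != m -> G m x -> p n x = 0) ->
  (forall x, exists2 r : seq int, uniq r & x = \sum_(n <- r) p n x) ->
  direct_sum_decomposition G.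
Proof.
move=> pG pid p0 psum x; exists (p^~ x); split.
  have [r ur xr] := psum x.
  have r0 n : n \notin r -> p n x = 0.
    move=> nr; rewrite xr raddf_sum big_seq big1 // => m mr.
    by apply: (p0 _ m) => //; apply: contraNneq nr => ->.
  split=> //.
    apply: sub_finite_set (finite_seq r) => n /= nx.
    by apply: contraNT nx => /r0 ->.
  rewrite (@fsbigE _ _ _ _ _ r) // => [|n _]; last exact: r0.
  by rewrite [LHS]xr; apply: eq_bigl => n; rewrite in_setT.
move=> c [cG cf xc]; apply/funext => n.
(* Uniqueness: the sum of [c] is made finite over its support so that [p n] can be applied term by
   term. *)
have cn0 m : m \notin fset_set [set i | c i != 0] -> c m = 0.
  by rewrite in_fset_set // notin_setE /= => /negP; rewrite negbK => /eqP.
rewrite xc (@fsbigE _ _ _ _ _ (fset_set [set i | c i != 0])) ?fset_uniq //;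
  last by move=> m _; exact: cn0.
rewrite raddf_sum big_mkcond (eq_bigr (fun m => if m == n then c n else 0)).
  have [nF|nF] := boolP (n \in fset_set [set i | c i != 0]).
    by rewrite (bigD1_seq n) ?fset_uniq //= eqxx big1 ?addr0 // => m /negPf->.
  by rewrite cn0 // big1 // => m _; rewrite if_same.
move=> m _; rewrite in_setT; have [->|mn] := eqVneq m n; first exact: pid.
by apply: (p0 _ m) => //; rewrite eq_sym.
Qed.

(** Induction on [n] in both directions from 0: a factor of degree 1 or -1 is split off the second
    factor and absorbed into the first, at every [m] at once. *)
Lemma strongly_graded_unit_steps (G : int -> set S) : graded G ->
  (forall n, G n `<=` setprod_sums (G 0) (G n)) ->
  (forall n, G n `<=` setprod_sums (G 1) (G (n - 1))) ->
  (forall n, G n `<=` setprod_sums (G (-1)) (G (n + 1))) ->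
  strongly_graded G.
Proof.
move=> gG G0 G1 GN1; have [_ _ GM] := gG.
have GGM n m a b : G n a -> G m b -> G (n + m) (numul a b).
  by move=> Ga Gb; apply: GM; exact: setprod_sumsM.
have trans k n m : G (n + m) `<=` setprod_sums (G n) (G m) ->
    G m `<=` setprod_sums (G k) (G (m - k)) ->
    G (n + m) `<=` setprod_sums (G (n + k)) (G (m - k)).
  move=> nm mk x /nm[s sAB ->]; apply: setprod_sums_sum => p /sAB[Gp /mk].
  by apply: setprod_sums_mull => a; exact: GGM.
split=> // n m; apply/seteqP; split; first exact: GM.
elim/int_ind: n m => [|n IHn|n IHn] m; first by rewrite add0r; exact: G0.
  have := @trans 1 n (m + 1) (IHn _); rewrite addrK.
  rewrite -[in _.+1%:Z]addn1 PoszD addrAC -addrA; apply.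
  by rewrite -{2}(addrK 1 m); exact: G1.
have := @trans (-1) (- n%:Z) (m - 1) (IHn _); rewrite opprK subrK.
rewrite -[in _.+1%:Z]addn1 PoszD opprD addrAC -addrA.
by apply; rewrite -{2}(subrK 1 m); exact: GN1.
Qed.

End NonUnitalRingTheory.

(** * The gradation of the Leavitt path algebra *)

Section MonoidAlgebra.
Variables (R : nzRingType) (K : monomType).
Implicit Types (f g : {malg R[K]}).

Lemma malgU_mul (c d : R) (u v : K) :
  << c *g u >> * << d *g v >> = << c * d *g mmul u v >> :> {malg R[K]}.
Proof. by rewrite malgM_def fgmulUU. Qed.

Lemma malg_ind (P : {malg R[K]} -> Prop) : P 0 ->
  (forall f g, P f -> P g -> P (f + g)) -> (forall c u, P << c *g u >>) ->
  forall f, P f.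
Proof. by move=> P0 PD PU f; rewrite [f]monalgE; elim/big_ind: _. Qed.

End MonoidAlgebra.

(** * Homogeneous parts in the free algebra *)

HB.lock Definition homog_part (R : nzRingType) (E : digraph) (n : int)
    (f : free_ualg R E) : free_ualg R E :=
  \sum_(w <- msupp f | @word_deg E w == n) << f@_w *g w >>.

Section Grading.
Variables (R : nzRingType) (E : digraph).
Local Notation FA := (free_ualg R E).
Local Notation FM := {fmonom (lpa_gen E)}.
Implicit Types (f g : FA) (u v w : FM) (c : R) (n : int).

Lemma word_degM (u v : FM) : word_deg (mmul u v) = word_deg u + word_deg v.
Proof. by rewrite /word_deg fmM big_cat. Qed.

Lemma word_degU (x : lpa_gen E) : word_deg (fmu x) = gen_deg x.
Proof. by rewrite /word_deg fmU big_seq1. Qed.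

Lemma word_deg_cons (x : lpa_gen E) s :
  word_deg (FMonom (x :: s)) = gen_deg x + word_deg (FMonom s).
Proof. by rewrite /word_deg big_cons. Qed.

Lemma mcoeff_homog_part n f w :
  (homog_part n f)@_w = if word_deg w == n then f@_w else 0.
Proof.
rewrite unlock raddf_sum /=.
have [wf|wf] := boolP (w \in msupp f); last first.
  rewrite (mcoeff_outdom wf) if_same big_seq_cond big1 // => u /andP[uf _].
  by rewrite mcoeffU; case: eqP => // uw; rewrite uw in uf; rewrite uf in wf.
rewrite big_mkcond (bigD1_seq w) ?fset_uniq //= big1 => [|u uw].
  by rewrite addr0 mcoeffUU.
by rewrite mcoeffU (negPf uw) if_same.
Qed.

Fact homog_part_is_zmod_morphism n : zmod_morphism (@homog_part R E n).
Proof.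
move=> f g; apply/malgP => w; rewrite mcoeffB 3!mcoeff_homog_part mcoeffB.
by case: ifP; rewrite ?subrr.
Qed.

HB.instance Definition _ n :=
  GRing.isZmodMorphism.Build FA FA (@homog_part R E n)
    (homog_part_is_zmod_morphism n).

Lemma homog_partD n f g :
  homog_part n (f + g) = homog_part n f + homog_part n g.
Proof. exact: raddfD. Qed.

Lemma homog_partU n c w :
  homog_part n << c *g w >> = if word_deg w == n then << c *g w >> else 0.
Proof.
apply/malgP => u; rewrite mcoeff_homog_part (fun_if (mcoeff u)) mcoeff0.
have [->//|wu] := eqVneq w u.
by rewrite mcoeffU (negPf wu) !if_same.
Qed.

Definition homogeneous (n : int) (f : FA) : Prop :=
  forall w, w \in msupp f -> word_deg w = n.

Lemma homogeneousU n c w : word_deg w = n -> homogeneous n << c *g w >>.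
Proof.
by move=> <- u; rewrite msuppU; case: ifP; rewrite ?inE // => _ /eqP->.
Qed.

Lemma homogeneousB n f g :
  homogeneous n f -> homogeneous n g -> homogeneous n (f - g).
Proof.
by move=> hf hg w /(fsubsetP (msuppB_le _ _)); rewrite inE => /orP[/hf|/hg].
Qed.

Lemma homogeneousM n m f g :
  homogeneous n f -> homogeneous m g -> homogeneous (n + m) (f * g).
Proof.
move=> hf hg w /(fsubsetP (msuppM_incl _ _)) /imfset2P[u /= uf [v /= vg ->]].
by rewrite word_degM (hf _ uf) (hg _ vg).
Qed.

Lemma homogeneous0 n : homogeneous n 0.
Proof. by move=> w; rewrite msupp0 inE. Qed.

Lemma homogeneousMn n f b : homogeneous n f -> homogeneous n (f *+ b).
Proof. by move=> hf w /(fsubsetP (msuppMn_le _ _)); exact: hf. Qed.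

Lemma homogeneous_sum n (I : Type) (r : seq I) (F : I -> FA) :
  (forall i, homogeneous n (F i)) -> homogeneous n (\sum_(i <- r) F i).
Proof.
move=> hF; elim/big_ind: _ => //; first exact: homogeneous0.
move=> f g hf hg w /(fsubsetP (msuppD_le _ _)).
by rewrite inE => /orP[/hf|/hg].
Qed.

Lemma homogeneous_part n f : homogeneous n (homog_part n f).
Proof.
move=> w; rewrite -mcoeff_neq0 mcoeff_homog_part.
by have [//|_] := eqVneq (word_deg w) n; rewrite eqxx.
Qed.

Lemma homog_part_id n f : homogeneous n f -> homog_part n f = f.
Proof.
move=> hf; apply/malgP => w; rewrite mcoeff_homog_part.
have [/hf->|/mcoeff_outdom->] := boolP (w \in msupp f); first by rewrite eqxx.
exact: if_same.
Qed.

Lemma homog_part_eq0 n m f : n != m -> homogeneous m f -> homog_part n f = 0.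
Proof.
move=> nm hf; apply/malgP => w; rewrite mcoeff_homog_part mcoeff0.
have [/hf->|/mcoeff_outdom->] := boolP (w \in msupp f); last exact: if_same.
by rewrite eq_sym (negPf nm).
Qed.

Lemma homog_part_sum f : exists r : seq int,
  uniq r /\ f = \sum_(n <- r) homog_part n f.
Proof.
exists (undup [seq word_deg w | w <- msupp f]); split; first exact: undup_uniq.
apply/malgP => w; rewrite raddf_sum /=.
under eq_bigr => n _ do rewrite mcoeff_homog_part.
rewrite -big_mkcond /=.
have [wf|/mcoeff_outdom->] := boolP (w \in msupp f); last by rewrite big1.
rewrite -big_filter; have -> : [seq n <- undup [seq word_deg u | u <- msupp f]
    | word_deg w == n] = [:: word_deg w]; last by rewrite big_seq1.
under eq_filter => n do rewrite eq_sym.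
rewrite filter_pred1_uniq ?undup_uniq // mem_undup.
by apply/mapP; exists w.
Qed.

(** A monomial is homogeneous, so multiplying by it only shifts degrees. Stated for monomials
    because the homogeneous part of a general product is a convolution. *)
Lemma homog_partMl n c (u : FM) f :
  homog_part n (<< c *g u >> * f) = << c *g u >> * homog_part (n - word_deg u) f.
Proof.
elim/malg_ind: f => [|f g IHf IHg|d v]; first by rewrite mulr0 !raddf0 mulr0.
  rewrite mulrDr homog_partD [in RHS]homog_partD mulrDr.
  exact: (congr2 _ IHf IHg).
rewrite malgU_mul !homog_partU word_degM addrC eq_sym -subr_eq eq_sym.
by case: ifP; rewrite ?mulr0 ?malgU_mul.
Qed.

Lemma homog_partMr n c (u : FM) f :
  homog_part n (f * << c *g u >>) = homog_part (n - word_deg u) f * << c *g u >>.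
Proof.
elim/malg_ind: f => [|f g IHf IHg|d v]; first by rewrite mul0r !raddf0 mul0r.
  rewrite mulrDl homog_partD [in RHS]homog_partD mulrDl.
  exact: (congr2 _ IHf IHg).
rewrite malgU_mul !homog_partU word_degM eq_sym -subr_eq eq_sym.
by case: ifP; rewrite ?mul0r ?malgU_mul.
Qed.

(** * Homogeneity of the defining ideal *)

Lemma homogeneous_gen x : homogeneous (gen_deg x) (gen R x).
Proof. by apply: homogeneousU; rewrite word_degU. Qed.

Lemma lpa_relator_homogeneous f : lpa_relator f -> exists n, homogeneous n f.
Proof.
have hV (v : vertex E) := @homogeneous_gen (GVertex v).
have hE e := @homogeneous_gen (GEdge e).
have hG e := @homogeneous_gen (GGhost e).
case=> [u v|e|e|e|e|e f'|v _ vf].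
- exists 0; apply: homogeneousB; first exact: (homogeneousM (hV u) (hV v)).
  by apply: homogeneousMn; exact: hV.
- exists 1; apply: homogeneousB; last exact: hE.
  exact: (homogeneousM (hV _) (hE e)).
- exists 1; apply: homogeneousB; last exact: hE.
  exact: (homogeneousM (hE e) (hV _)).
- exists (-1); apply: homogeneousB; last exact: hG.
  exact: (homogeneousM (hV _) (hG e)).
- exists (-1); apply: homogeneousB; last exact: hG.
  exact: (homogeneousM (hG e) (hV _)).
- exists 0; apply: homogeneousB; first exact: (homogeneousM (hG e) (hE f')).
  by apply: homogeneousMn; exact: hV.
- exists 0; apply: homogeneousB; last exact: hV.
  rewrite fsbig_finite //; apply: homogeneous_sum => e.
  exact: (homogeneousM (hE e) (hG e)).
Qed.

Lemma lpa_idealN (f : FA) : lpa_ideal f -> lpa_ideal (- f).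
Proof. by move=> If; rewrite -sub0r; apply: idealB => //; exact: ideal0. Qed.

Lemma lpa_idealD (f g : FA) : lpa_ideal f -> lpa_ideal g -> lpa_ideal (f + g).
Proof. by move=> If /lpa_idealN Ig; rewrite -[g]opprK; exact: idealB. Qed.

(** The generators of the ideal are homogeneous, and multipliers are split into monomials. A
    monomial shifts the degree, so the induction hypothesis is kept for all [n]. *)
Lemma lpa_ideal_homog_part n f : lpa_ideal f -> lpa_ideal (homog_part n f).
Proof.
move=> If; elim: If n => {f} [f relf|| f g _ IHf _ IHg|a f _ IHf|f a _ IHf] n.
- have [m hf] := lpa_relator_homogeneous relf.
  have [nm|nm] := eqVneq n m; last by rewrite (homog_part_eq0 nm hf); exact: ideal0.
  by rewrite nm homog_part_id //; exact: ideal_relator.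
- have -> : homog_part n 0 = 0 :> FA by exact: raddf0.
  exact: ideal0.
- have -> : homog_part n (f - g) = homog_part n f - homog_part n g by exact: raddfB.
  exact: idealB.
- elim/malg_ind: a => [|a b IHa IHb|c u].
  + by rewrite mul0r raddf0; exact: ideal0.
  + by rewrite mulrDl homog_partD; exact: lpa_idealD.
  + by rewrite homog_partMl; exact: idealMl.
- elim/malg_ind: a => [|a b IHa IHb|c u].
  + by rewrite mulr0 raddf0; exact: ideal0.
  + by rewrite mulrDr homog_partD; exact: lpa_idealD.
  + by rewrite homog_partMr; exact: idealMr.
Qed.

(** * The induced gradation on the quotient *)

Fact homog_part_no_const n (x : free_alg R E) :
  homog_part n (val x) \in @no_const R E.
Proof.
rewrite unfold_in mcoeff_homog_part; have /eqP-> := free_algP x.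
by rewrite if_same.
Qed.

Definition free_homog_part n (x : free_alg R E) : free_alg R E :=
  FreeAlg (homog_part_no_const n x).

Definition lpa_homog_part n (x : lpa R E) : lpa R E :=
  lpa_pi (free_homog_part n (repr x)).

Lemma lpa_reprK (x : lpa R E) : lpa_pi (repr x) = x.
Proof. by rewrite /lpa_pi reprK. Qed.

Lemma lpa_numul_pi (f g : free_alg R E) :
  numul (lpa_pi f) (lpa_pi g) = lpa_pi (numul f g).
Proof. by rewrite (lpa_piM f g). Qed.

Lemma lpa_pi_eq (x y : free_alg R E) :
  lpa_pi x = lpa_pi y <-> lpa_ideal (val x - val y).
Proof. by split=> [/lpa_piP/asboolP|?]; last by apply/lpa_piP/asboolP. Qed.

(** Independence of the chosen representative: two representatives differ by an element of the
    ideal, which is stable under taking homogeneous parts. *)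
Lemma lpa_homog_part_pi n (x : free_alg R E) :
  lpa_homog_part n (lpa_pi x) = lpa_pi (free_homog_part n x).
Proof.
apply/lpa_pi_eq => /=; rewrite -raddfB; apply: lpa_ideal_homog_part.
by apply/lpa_pi_eq; rewrite lpa_reprK.
Qed.

Fact lpa_pi_is_zmod_morphism : zmod_morphism (@lpa_pi R E).
Proof. by move=> x y; rewrite /lpa_pi raddfB. Qed.

HB.instance Definition _ := GRing.isZmodMorphism.Build (free_alg R E) (lpa R E)
  (@lpa_pi R E) lpa_pi_is_zmod_morphism.

Fact lpa_homog_part_is_zmod_morphism n : zmod_morphism (lpa_homog_part n).
Proof.
move=> x y; rewrite -[x]lpa_reprK -[y]lpa_reprK -raddfB !lpa_homog_part_pi -raddfB.
by congr lpa_pi; apply: val_inj; rewrite /= raddfB.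
Qed.

HB.instance Definition _ n := GRing.isZmodMorphism.Build (lpa R E) (lpa R E)
  (lpa_homog_part n) (lpa_homog_part_is_zmod_morphism n).

(** Turns membership in an image under [lpa_pi] into a fixed-point equation for an additive map. *)
Lemma lpa_componentP n (x : lpa R E) :
  lpa_component n x <-> lpa_homog_part n x = x.
Proof.
split=> [[f hf <-]|<-].
  by rewrite lpa_homog_part_pi; congr lpa_pi; apply: val_inj; exact: homog_part_id.
exists (free_homog_part n (repr x)) => //; exact: homogeneous_part.
Qed.

Lemma lpa_homog_part_eq0 n m (x : lpa R E) :
  n != m -> lpa_component m x -> lpa_homog_part n x = 0.
Proof.
move=> nm [f hf <-]; rewrite lpa_homog_part_pi -(raddf0 (@lpa_pi R E)).
by congr lpa_pi; apply: val_inj; exact: (homog_part_eq0 nm).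
Qed.

Lemma lpa_componentB n (x y : lpa R E) :
  lpa_component n x -> lpa_component n y -> lpa_component n (x - y).
Proof.
move=> /lpa_componentP hx /lpa_componentP hy; apply/lpa_componentP.
by rewrite raddfB /= hx hy.
Qed.

Lemma lpa_component0 n : lpa_component n (0 : lpa R E).
Proof. by apply/lpa_componentP; rewrite raddf0. Qed.

Lemma lpa_componentM n m (x y : lpa R E) :
  lpa_component n x -> lpa_component m y -> lpa_component (n + m) (numul x y).
Proof.
move=> [f hf <-] [g hg <-]; exists (numul f g); last exact: lpa_piM.
exact: homogeneousM.
Qed.

Lemma lpa_component_part n (x : lpa R E) : lpa_component n (lpa_homog_part n x).
Proof.
by exists (free_homog_part n (repr x)) => //; exact: homogeneous_part.
Qed.

Lemma lpa_homog_part_sum (x : lpa R E) :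
  exists2 r : seq int, uniq r & x = \sum_(n <- r) lpa_homog_part n x.
Proof.
have [r [ur fr]] := homog_part_sum (val (repr x)); exists r => //.
rewrite -{1}[x]lpa_reprK -raddf_sum; congr lpa_pi; apply: val_inj.
by rewrite [LHS]fr raddf_sum.
Qed.

Theorem lpa_graded : graded (@lpa_component R E).
Proof.
split=> [n||n m x [s sG ->]].
- by split=> [|x y]; [exact: lpa_component0 | exact: lpa_componentB].
- apply: (@direct_sum_decomposition_proj _ _ lpa_homog_part).
  + exact: lpa_component_part.
  + by move=> n x /lpa_componentP.
  + exact: lpa_homog_part_eq0.
  + exact: lpa_homog_part_sum.
- rewrite big_seq; elim/big_ind: _ => [||p /sG[]]; last exact: lpa_componentM.
    exact: lpa_component0.
  move=> y z Gy Gz; rewrite -[z]opprK; apply: lpa_componentB => //.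
  by rewrite -sub0r; apply: lpa_componentB => //; exact: lpa_component0.
Qed.

(** * Generators and relations in the Leavitt path algebra *)

Fact gen_no_const (g : lpa_gen E) : gen R g \in @no_const R E.
Proof. by rewrite unfold_in mcoeffU fm1_eq1. Qed.

Definition lpa_gen_elt (g : lpa_gen E) : lpa R E := lpa_pi (FreeAlg (gen_no_const g)).

Lemma lpa_component_gen (g : lpa_gen E) : lpa_component (gen_deg g) (lpa_gen_elt g).
Proof.
by exists (FreeAlg (gen_no_const g)) => //; exact: homogeneous_gen.
Qed.


Lemma lpa_pi_relator (x y : free_alg R E) :
  lpa_relator (val x - val y) -> lpa_pi x = lpa_pi y.
Proof. by move=> rel; apply/lpa_pi_eq; exact: ideal_relator. Qed.

Local Notation V v := (lpa_gen_elt (GVertex v)).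
Local Notation X e := (lpa_gen_elt (GEdge e)).
Local Notation X' e := (lpa_gen_elt (GGhost e)).

Lemma lpa_vertex_idem (v : vertex E) : numul (V v) (V v) = V v.
Proof.
rewrite lpa_numul_pi; apply: lpa_pi_relator.
by have := rel_vertex R v v; rewrite eqxx.
Qed.

Lemma lpa_src_edge (e : edge E) : numul (V (src e)) (X e) = X e.
Proof. by rewrite lpa_numul_pi; apply: lpa_pi_relator; exact: rel_src. Qed.

Lemma lpa_tgt_ghost (e : edge E) : numul (V (tgt e)) (X' e) = X' e.
Proof. by rewrite lpa_numul_pi; apply: lpa_pi_relator; exact: rel_ghost_tgt. Qed.

Lemma lpa_CK1 (e : edge E) : numul (X' e) (X e) = V (tgt e).
Proof.
rewrite lpa_numul_pi; apply: lpa_pi_relator.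
by have := rel_CK1 R e e; rewrite eqxx.
Qed.

Lemma lpa_CK2 (v : vertex E) : out_edges v !=set0 -> finite_set (out_edges v) ->
  V v = \sum_(e <- fset_set (out_edges v)) numul (X e) (X' e).
Proof.
move=> v0 vf; under eq_bigr => e _ do rewrite lpa_numul_pi.
rewrite -raddf_sum; apply/esym/lpa_pi_relator; rewrite raddf_sum /=.
by have := rel_CK2 R v0 vf; rewrite fsbig_finite.
Qed.

(** Replaces the missing unit: an element is a sum of monomials with non-empty words, and each of
    these is fixed on the left by the vertex belonging to its first letter. *)
Lemma lpa_component_ind n (P : lpa R E -> Prop) :
  P 0 -> (forall x y, P x -> P y -> P (x + y)) ->
  (forall (v : vertex E) x, lpa_component n x -> numul (V v) x = x -> P x) ->
  forall x, lpa_component n x -> P x.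
Proof.
move=> P0 PD PV _ [f hf <-].
(* The default 0 never intervenes for a monomial of [f], since [f] has no constant term. *)
pose mono c w : free_alg R E := insubd 0 << c *g w >>.
have monoE w : w \in msupp (val f) -> val (mono (val f)@_w w) = << (val f)@_w *g w >>.
  move=> wf; suff wE : << (val f)@_w *g w >> \in @no_const R E by exact: insubdK wE.
  rewrite unfold_in mcoeffU.
  have [w1|//] := eqVneq w _; have := free_algP f.
  by rewrite unfold_in -w1 => /eqP ->; rewrite mul0rn.
have -> : f = \sum_(w <- msupp (val f)) mono (val f)@_w w.
  apply: val_inj; rewrite raddf_sum [LHS]monalgE /=.
  by rewrite big_seq [RHS]big_seq; apply: eq_bigr => w /monoE ->.
rewrite raddf_sum big_seq; elim/big_ind: _ => // w wf.
have [g [s ws]] : exists (g : lpa_gen E) s, w = FMonom (g :: s).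
  case: w wf => -[|g s] wf; last by exists g, s.
  by move: wf; rewrite -mcoeff_neq0 -fmoneE (eqP (free_algP f)) eqxx.
(* The vertex that acts as a left identity on the first letter [g]. *)
pose v := match g with
  | GVertex v => v | GEdge e => src e | GGhost e => tgt e end.
have rel : lpa_relator (gen R (GVertex v) * gen R g - gen R g).
  rewrite /v; case: (g) => [u|e|e]; [|exact: rel_src|exact: rel_ghost_tgt].
  by have := rel_vertex R u u; rewrite eqxx.
apply: (PV v).
  exists (mono (val f)@_w w) => //; rewrite /free_component /= monoE //.
  by apply: homogeneousU; exact: hf.
rewrite lpa_numul_pi; apply/lpa_pi_eq; rewrite /= monoE //.
have -> : << (val f)@_w *g w >> = gen R g * << (val f)@_w *g FMonom s >>.
  by rewrite malgU_mul mul1r ws; congr << _ *g _ >>; apply/eqP; rewrite fmP fmM fmU.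
by rewrite mulrA -mulrBl; apply: idealMr; exact: ideal_relator.
Qed.

End Grading.

(** * Representations on boundary paths *)

(** The vertices at which relation (4) is imposed: neither sinks nor infinite emitters. *)
Definition regular (E : digraph) (v : vertex E) : Prop :=
  out_edges v !=set0 /\ finite_set (out_edges v).

(* [bs_cons e y x] reads x = e y: the points are abstract boundary paths. *)
Record branching_system (E : digraph) := BranchingSystem {
  bs_point :> Type;
  bs_src : bs_point -> vertex E;
  bs_cons : edge E -> bs_point -> bs_point -> Prop;
  bs_cons_inj : forall e e' y y' x,
    bs_cons e y x -> bs_cons e' y' x -> e = e' /\ y = y';
  bs_cons_fun : forall e y x x', bs_cons e y x -> bs_cons e y x' -> x = x';
  bs_cons_src : forall e y x, bs_cons e y x -> bs_src x = src e;
  bs_cons_tgt : forall e y x, bs_cons e y x -> bs_src y = tgt e;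
  bs_cons_ex : forall e y, bs_src y = tgt e -> exists x, bs_cons e y x;
  bs_regular : forall x, regular (bs_src x) -> exists e y, bs_cons e y x
}.

Section Representation.
Variables (R : nzRingType) (E : digraph) (X : branching_system E).
Local Notation FA := (free_ualg R E).
Local Notation FM := {fmonom (lpa_gen E)}.
Implicit Types (f : FA) (w : FM) (x y z : X).

Definition gen_rel (g : lpa_gen E) x y : Prop :=
  match g with
  | GVertex v => x = y /\ bs_src x = v
  | GEdge e => bs_cons e x y
  | GGhost e => bs_cons e y x
  end.

(** Reads s x = y, with the last letter acting first, so that concatenation of words is composition.
    It is a relation because the action is only partially defined. *)
Fixpoint word_rel (s : seq (lpa_gen E)) x y : Prop :=
  if s is g :: s' then exists2 z, word_rel s' x z & gen_rel g z y else x = y.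

Lemma gen_rel_fun g x y y' : gen_rel g x y -> gen_rel g x y' -> y = y'.
Proof.
case: g => [v|e|e] /=; first by move=> [<- _] [<- _].
  exact: bs_cons_fun.
by move=> c /(bs_cons_inj c)[].
Qed.

Lemma gen_rel_inj g x x' y : gen_rel g x y -> gen_rel g x' y -> x = x'.
Proof.
case: g => [v|e|e] /=; first by move=> [-> _] [-> _].
  by move=> c /(bs_cons_inj c)[].
exact: bs_cons_fun.
Qed.

Lemma word_rel_fun s x y y' : word_rel s x y -> word_rel s x y' -> y = y'.
Proof.
elim: s y y' => [|g s IHs] y y' /=; first by move=> <-.
by move=> [z xz zy] [z' /(IHs _ _ xz)<-]; exact: gen_rel_fun.
Qed.

Lemma word_rel_inj s x x' y : word_rel s x y -> word_rel s x' y -> x = x'.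
Proof.
elim: s y => [|g s IHs] y /=; first by move=> -> ->.
move=> [z xz /gen_rel_inj zy] [z' x'z' /zy zz']; rewrite -zz' in x'z'.
exact: IHs xz x'z'.
Qed.

Lemma word_rel_cat s t x y :
  word_rel (s ++ t) x y <-> exists2 z, word_rel t x z & word_rel s z y.
Proof.
elim: s y => [|g s IHs] y /=; first by split=> [?|[z ? <-]]; first exists y.
split=> [[z /IHs[z' xz' z'z] zy]|[z xz [z' zz' z'y]]].
  by exists z' => //; exists z.
by exists z' => //; apply/IHs; exists z.
Qed.

(* The matrix entry of f at (x, y) in the representation of the free algebra on
   the free R-module over the points. *)
Definition path_coef x y : FA -> R :=
  mmap idfun (fun w => `[< word_rel w x y >]%:R).

HB.instance Definition _ x y := GRing.Additive.on (path_coef x y).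

Lemma path_coefD x y f g :
  path_coef x y (f + g) = path_coef x y f + path_coef x y g.
Proof. exact: raddfD. Qed.

Lemma path_coefU x y c w :
  path_coef x y << c *g w >> = c * `[< word_rel w x y >]%:R.
Proof. by rewrite /path_coef mmapU. Qed.

(** Words act by partial injections, so the matrix product with a monomial has at most one
    intermediate point, here [z]; no sum over points arises. *)
Lemma path_coefMl x z y c w f : word_rel w z y ->
  path_coef x y (<< c *g w >> * f) = c * path_coef x z f.
Proof.
move=> zy; elim/malg_ind: f => [|f g IHf IHg|d u].
- by rewrite mulr0 !raddf0 mulr0.
- rewrite mulrDr path_coefD [in RHS]path_coefD mulrDr.
  exact: (congr2 _ IHf IHg).
- rewrite malgU_mul !path_coefU mulrA; congr (_ * (nat_of_bool _)%:R).
  apply: asbool_equiv_eq; rewrite fmM; split=> [/word_rel_cat[z' xz' z'y]|xz].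
    by rewrite (word_rel_inj zy z'y).
  by apply/word_rel_cat; exists z.
Qed.

Lemma path_coefMl0 x y c w f : (forall z, ~ word_rel w z y) ->
  path_coef x y (<< c *g w >> * f) = 0.
Proof.
move=> Ny; elim/malg_ind: f => [|f g IHf IHg|d u].
- by rewrite mulr0 raddf0.
- rewrite mulrDr path_coefD -[RHS]addr0; exact: (congr2 _ IHf IHg).
- rewrite malgU_mul path_coefU asboolF ?mulr0 // fmM.
  by move=> /word_rel_cat[z' _ /Ny].
Qed.

Lemma path_coefMr x z y c w f : word_rel w x z ->
  path_coef x y (f * << c *g w >>) = path_coef z y f * c.
Proof.
move=> xz; elim/malg_ind: f => [|f g IHf IHg|d u].
- by rewrite mul0r !raddf0 mul0r.
- rewrite mulrDl path_coefD [in RHS]path_coefD mulrDl.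
  exact: (congr2 _ IHf IHg).
(* [R] need not be commutative: only the entry 0 or 1 of the word is moved past [c]. *)
- rewrite malgU_mul !path_coefU -!mulrA [c * _]commr_nat.
  congr (_ * ((nat_of_bool _)%:R * _)).
  apply: asbool_equiv_eq; rewrite fmM; split=> [/word_rel_cat[z' xz' z'y]|zy].
    by rewrite (word_rel_fun xz xz').
  by apply/word_rel_cat; exists z.
Qed.

Lemma path_coefMr0 x y c w f : (forall z, ~ word_rel w x z) ->
  path_coef x y (f * << c *g w >>) = 0.
Proof.
move=> Nx; elim/malg_ind: f => [|f g IHf IHg|d u].
- by rewrite mul0r raddf0.
- rewrite mulrDl path_coefD -[RHS]addr0; exact: (congr2 _ IHf IHg).
- rewrite malgU_mul path_coefU asboolF ?mulr0 // fmM.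
  by move=> /word_rel_cat[z' /Nx].
Qed.

Lemma path_coef_gen x y g : path_coef x y (gen R g) = `[< gen_rel g x y >]%:R.
Proof.
rewrite path_coefU mul1r fmU; congr (nat_of_bool _)%:R.
by apply: asbool_equiv_eq; split=> [[z ->]|?] //; exists x.
Qed.

Lemma path_coef_gen2 x y g h : path_coef x y (gen R g * gen R h) =
  `[< exists2 z, gen_rel h x z & gen_rel g z y >]%:R.
Proof.
rewrite malgU_mul path_coefU !mul1r fmM !fmU; congr (nat_of_bool _)%:R.
apply: asbool_equiv_eq; split=> [[z [z' ->]]|[z xz zy]]; first by exists z.
by exists z => //; exists x.
Qed.

(** For all relations but the last, the two sides act by the same partial map. For the last one, e
    e^* projects onto the points that begin with e, and a point whose source is a regular vertex
    begins with exactly one edge. *)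
Lemma path_coef_relator x y f : lpa_relator f -> path_coef x y f = 0.
Proof.
have sub0 (P Q : Prop) : (P <-> Q) -> `[<P>]%:R - `[<Q>]%:R = 0 :> R.
  by move/asbool_equiv_eq->; rewrite subrr.
case=> {f} [u v|e|e|e|e|e e'|v v0 vf];
  rewrite raddfB ?raddfMn /= ?path_coef_gen2 ?path_coef_gen.
- have [->|uv] := eqVneq u v.
    rewrite mulr1n; apply: sub0; split=> [[z [<- xv] []]//|[<- xv]].
    by exists x.
  rewrite mulr0n addr0 asboolF // => -[z [<- xv] [_ xu]].
  by move: uv; rewrite -xu xv eqxx.
- apply: sub0; split=> [[z xz [<-]]//|xy]; exists y => //.
  by split=> //; exact: bs_cons_src xy.
- apply: sub0; split=> [[z [<-]]//|xy]; exists x => //.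
  by split=> //; exact: bs_cons_tgt xy.
- apply: sub0; split=> [[z xz [<-]]//|xy]; exists y => //.
  by split=> //; exact: bs_cons_tgt xy.
- apply: sub0; split=> [[z [<-]]//|xy]; exists x => //.
  by split=> //; exact: bs_cons_src xy.
- have [->|ee'] := eqVneq e e'; last first.
    rewrite mulr0n addr0 asboolF // => -[z xz /(bs_cons_inj xz)[ee _]].
    by move: ee'; rewrite ee eqxx.
  rewrite mulr1n; apply: sub0; split=> [[z xz yz]|[<- /bs_cons_ex[z xz]]].
    by have [_ xy] := bs_cons_inj xz yz; split=> //; exact: bs_cons_tgt xz.
  by exists z.
- rewrite fsbig_finite // raddf_sum (eq_bigr _ (fun e _ => path_coef_gen2 x y _ _)).
  have [xv|xv] := pselect (bs_src x = v); last first.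
    rewrite (asboolF (P := gen_rel _ _ _)) => [|[]//]; rewrite subr0.
    rewrite big_seq big1 // => e; rewrite in_fset_set // inE => ev.
    by rewrite asboolF // => -[z /bs_cons_src xe _]; apply: xv; rewrite xe.
  (* Only the term of the first edge [e0] of [x] survives in the sum. *)
  have [e0 [z0 x0]] : exists e y, bs_cons e y x by apply: bs_regular; rewrite xv.
  have e0v : e0 \in fset_set (out_edges v).
    by rewrite in_fset_set // inE; rewrite -xv /out_edges /= (bs_cons_src x0).
  rewrite (bigD1_seq e0) ?fset_uniq //= big1 => [|e ee0]; last first.
    rewrite asboolF // => -[z /(bs_cons_inj x0)[e0e _] _].
    by move: ee0; rewrite e0e eqxx.
  rewrite addr0; apply: sub0; split=> [[z /(bs_cons_inj x0)[_ <-]]|[<- _]].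
    by move=> /(bs_cons_fun x0).
  by exists z0.
Qed.

(** A monomial multiplier either annihilates the entry or moves it to another pair of points, so the
    induction is over all [x] and [y]. *)
Lemma path_coef_ideal x y f : lpa_ideal f -> path_coef x y f = 0.
Proof.
move=> If; elim: If x y => {f} [f relf|| f g _ IHf _ IHg|a f _ IHf|f a _ IHf] x y.
- exact: path_coef_relator.
- exact: raddf0.
- have -> : path_coef x y (f - g) = path_coef x y f - path_coef x y g.
    exact: raddfB.
  by rewrite IHf IHg subr0.
- elim/malg_ind: a => [|a b IHa IHb|c w].
  + by rewrite mul0r raddf0.
  + rewrite mulrDl path_coefD -[RHS]addr0; exact: (congr2 _ IHa IHb).
  + have [[z zy]|Ny] := pselect (exists z, word_rel w z y).
      by rewrite (path_coefMl _ _ _ zy) IHf mulr0.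
    by apply: path_coefMl0 => z zy; apply: Ny; exists z.
- elim/malg_ind: a => [|a b IHa IHb|c w].
  + by rewrite mulr0 raddf0.
  + rewrite mulrDr path_coefD -[RHS]addr0; exact: (congr2 _ IHa IHb).
  + have [[z xz]|Nx] := pselect (exists z, word_rel w x z).
      by rewrite (path_coefMr _ _ _ xz) IHf mul0r.
    by apply: path_coefMr0 => z xz; apply: Nx; exists z.
Qed.

(** * Matrix entries of elements of the Leavitt path algebra *)

Definition lpa_coef x y (a : lpa R E) : R := path_coef x y (val (repr a)).

Lemma lpa_coef_pi x y (f : free_alg R E) :
  lpa_coef x y (lpa_pi f) = path_coef x y (val f).
Proof.
apply/eqP; rewrite -subr_eq0 /lpa_coef -raddfB; apply/eqP.
by apply: path_coef_ideal; apply/lpa_pi_eq; rewrite lpa_reprK.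
Qed.

Fact lpa_coef_is_zmod_morphism x y : zmod_morphism (lpa_coef x y).
Proof.
move=> a b; rewrite -[a]lpa_reprK -[b]lpa_reprK -raddfB !lpa_coef_pi.
exact: raddfB.
Qed.

HB.instance Definition _ x y := GRing.isZmodMorphism.Build (lpa R E) R
  (lpa_coef x y) (lpa_coef_is_zmod_morphism x y).

Lemma path_coefM_eq0 x y f (g : FA) :
  (forall w, w \in msupp g -> forall z, ~ word_rel w x z) ->
  path_coef x y (f * g) = 0.
Proof.
move=> Nx; rewrite {1}[g]monalgE mulr_sumr raddf_sum big_seq big1 // => w wg.
by apply: path_coefMr0; exact: Nx.
Qed.

(** The source of [x], as a vertex of degree 0, is a sum of products f g with g of degree [m]. Its
    entry at [(x, x)] is 1, whereas every f g would have entry 0 if no word of degree [m] were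
    defined at [x]. *)
Lemma strongly_graded_word_rel m x : strongly_graded (@lpa_component R E) ->
  exists w z, word_deg w = m /\ word_rel w x z.
Proof.
move=> [_ /(_ (- m) m) GE]; apply: contrapT => Nx.
have := lpa_component_gen R (GVertex (bs_src x)).
rewrite -[gen_deg _]/(0 : int) -(addNr m) -GE => -[s sG /(congr1 (lpa_coef x x))].
rewrite lpa_coef_pi path_coef_gen asboolT //= raddf_sum big_seq big1.
  by move/eqP; rewrite oner_eq0.
move=> p /sG[[f _ <-] [g gm <-]]; rewrite lpa_numul_pi [LHS]lpa_coef_pi.
by apply: path_coefM_eq0 => w /gm wm z xz; apply: Nx; exists w, z.
Qed.

End Representation.

(** * Finite and infinite paths *)

Section Paths.
Variable E : digraph.
Implicit Types (v : vertex E) (e : edge E) (p q : ipath E).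

Lemma fpath_ext (a b : fpath E) :
  fpath_src a = fpath_src b -> fpath_edges a = fpath_edges b -> a = b.
Proof.
case: a b => [v s ch] [v' s' ch'] /= vv' ss'; subst v' s'.
by rewrite (Prop_irrelevance ch ch').
Qed.

Lemma ipath_ext p q : p =1 q -> p = q.
Proof.
case: p q => [p pP] [q qP] /= /funext pq; subst q.
by rewrite (Prop_irrelevance pP qP).
Qed.

(** * The finite paths ending at a non-regular vertex *)

Definition path_into v := {a : fpath E | fpath_tgt a = v}.

Definition path_into_cons v e (b a : path_into v) : Prop :=
  fpath_edges (sval a) = e :: fpath_edges (sval b) /\
  fpath_src (sval b) = tgt e.

Lemma path_into_cons_src v e (b a : path_into v) :
  path_into_cons e b a -> fpath_src (sval a) = src e.
Proof. by case=> ae _; have := fpathP (sval a); rewrite ae => -[]. Qed.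

Lemma path_into_ext v (a b : path_into v) : sval a = sval b -> a = b.
Proof. by case: a b => [a av] [b bv] /=; exact: eq_exist. Qed.

(** The path of length 0 has no first edge; its source is [v], so [Nv] exempts it from
    [bs_regular]. *)
Definition path_into_branching v (Nv : ~ regular v) : branching_system E.
Proof.
apply: (@BranchingSystem E (path_into v) (fun a => fpath_src (sval a))
  (@path_into_cons v)).
- move=> e e' b b' a [ae be] [ae' be'].
  have [ee' bb'] : e :: fpath_edges (sval b) = e' :: fpath_edges (sval b').
    by rewrite -ae -ae'.
  split=> //; apply/path_into_ext/fpath_ext => //.
  by rewrite be be' ee'.
- move=> e b a a' ba ba'; apply/path_into_ext/fpath_ext.
    by rewrite (path_into_cons_src ba) (path_into_cons_src ba').
  by rewrite ba.1 ba'.1.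
- exact: path_into_cons_src.
- by move=> e b a [].
- move=> e [b bv] /= be.
  have ch : chain (src e) (e :: fpath_edges b).
    by split=> //; rewrite -be; exact: fpathP.
  have tv : fpath_tgt (FPath ch) = v by rewrite -bv /fpath_tgt /= be.
  by exists (exist _ (FPath ch) tv).
- move=> [a av]; case ae: (fpath_edges a) => [|e s] /=.
    have -> : fpath_src a = v by rewrite -av /fpath_tgt ae.
    by move=> /Nv.
  move=> _; have := fpathP a; rewrite ae /= => -[ea ch].
  have tv : fpath_tgt (FPath ch) = v by rewrite -av /fpath_tgt ae.
  by exists e, (exist _ (FPath ch) tv).
Defined.

(** Each letter changes the length of a path by exactly its degree. *)
Lemma path_into_word_rel v (Nv : ~ regular v) s
    (a b : path_into_branching Nv) : word_rel s a b ->
  (fpath_len (sval b))%:Z = (fpath_len (sval a))%:Z + word_deg (FMonom s).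
Proof.
elim: s b => [|g s IHs] b /=; first by rewrite /word_deg big_nil addr0 => ->.
rewrite word_deg_cons addrCA => -[c /IHs <-].
case: g => [u|e|e] /=; first by move=> [-> _]; rewrite add0r.
  by move=> [be _]; rewrite /fpath_len be /= -addn1 PoszD addrC.
by move=> [ce _]; rewrite /fpath_len ce /= -addn1 PoszD addrCA addNr addr0.
Qed.

(** * Infinite paths as boundary paths *)

Definition ipath_cons e q p : Prop := p 0%N = e /\ forall i, p i.+1 = q i.

Definition ipath_branching : branching_system E.
Proof.
apply: (@BranchingSystem E (ipath E) (fun p => src (p 0%N)) ipath_cons).
- move=> e e' q q' p [<- pq] [<- pq']; split=> //.
  by apply: ipath_ext => i; rewrite -pq pq'.
- move=> e q p p' [p0 pq] [p0' pq']; apply: ipath_ext => -[|i].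
    by rewrite p0 p0'.
  by rewrite pq pq'.
- by move=> e q p [<-].
- by move=> e q p [<- pq]; rewrite -pq -ipathP.
- move=> e q qe.
  have pP i : tgt (if i is j.+1 then q j else e) = src (q i).
    by case: i => [|i] //; exact: ipathP.
  by exists (IPath pP).
- move=> p _; have qP i : tgt (p i.+1) = src (p i.+2) by exact: ipathP.
  by exists (p 0%N), (IPath qP).
Defined.

(** Infinite paths have no length, so the degree appears as a lag: [p] without its first [i] edges
    is [q] without its first [j] edges. *)
Lemma ipath_word_rel s (p q : ipath_branching) : word_rel s p q ->
  exists i j : nat, [/\ j%:Z - i%:Z = word_deg (FMonom s)
    & forall l, (p : ipath E) (i + l)%N = (q : ipath E) (j + l)%N].
Proof.
elim: s q => [|g s IHs] q /=.
  by move=> ->; exists 0%N, 0%N; split; rewrite // /word_deg big_nil subrr.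
move=> [z /IHs[i [j [ij pz]]]]; rewrite word_deg_cons -ij.
case: g => [u|e|e] /=.
- by move=> [<- _]; exists i, j; split; rewrite ?add0r.
- move=> [_ zq]; exists i, j.+1; split=> [|l]; last by rewrite pz -zq.
  by rewrite -addn1 PoszD addrAC addrC.
(* Since [j] may be 0, the lag is adjusted by shortening the common tail: [i] grows instead of [j]
   decreasing. *)
- move=> [_ zq]; exists i.+1, j; split=> [|l]; last by rewrite addSnnS pz addnS zq.
  by rewrite -addn1 PoszD opprD addrA addrC.
Qed.

(** * Initial subpaths of infinite paths *)

Fact iprefix_chain p k n : chain (src (p k)) (map p (iota k n)).
Proof.
elim: n k => [|n IHn] k //=; split=> //.
by rewrite ipathP.
Qed.

Definition iprefix p n : fpath E := FPath (iprefix_chain p 0%N n).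

Lemma iprefix_tgt p n : fpath_tgt (iprefix p n) = src (p n).
Proof.
rewrite /fpath_tgt /= -[n in RHS]add0n; elim: n (0%N) => [|n IHn] k /=.
  by rewrite addn0.
by rewrite ipathP IHn addSnnS.
Qed.

Lemma iprefix_len p n : fpath_len (iprefix p n) = n.
Proof. by rewrite /fpath_len /= size_map size_iota. Qed.

Lemma iprefix_initial p n : initial_subpath (iprefix p n) p.
Proof.
have qP i : tgt (p (n + i)%N) = src (p (n + i.+1)%N) by rewrite addnS ipathP.
exists (IPath qP) => /=; first by rewrite iprefix_tgt addn0.
(* The segment may start at any position [k], which the induction on [n] advances. *)
suff icatE k i : icat (map p (iota k n)) (fun i => p (k + n + i)%N) i = p (k + i)%N.
  by move=> i; rewrite -[LHS](icatE 0%N).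
elim: n k i {qP} => [|n IHn] k [|i] //=; rewrite ?addn0 //.
rewrite -[(k + i.+1)%N]addSnnS -IHn; congr (icat _ _ _).
by apply/funext => l; rewrite addSnnS.
Qed.

Lemma icat_size (s : seq (edge E)) (q : nat -> edge E) : icat s q (size s) = q 0%N.
Proof. by elim: s. Qed.

Lemma initial_subpath_tgt (a : fpath E) p :
  initial_subpath a p -> fpath_tgt a = src (p (fpath_len a)).
Proof. by move=> [q -> ->]; rewrite icat_size. Qed.

End Paths.

(** * Necessity of the conditions on the graph *)

Section Necessity.
Variables (R : nzRingType) (E : digraph).

(** Otherwise a word of degree -1 would send the path of length 0 at [v] to a path of length -1. *)
Lemma strongly_graded_regular (v : vertex E) :
  strongly_graded (@lpa_component R E) -> regular v.
Proof.
move=> strongE; apply: contrapT => Nv; have vv : @chain E v [::] by [].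
pose a : path_into_branching Nv := exist _ (FPath vv) erefl.
have [w [b [wN1 /path_into_word_rel]]] := strongly_graded_word_rel (-1) a strongE.
by rewrite fmK wN1 /= add0r.
Qed.

Lemma strongly_graded_condition_Y :
  strongly_graded (@lpa_component R E) -> condition_Y E.
Proof.
move=> strongE k _ p; pose x : ipath_branching E := p.
have [w [q [wk /ipath_word_rel[i [j [ij pq]]]]]] :=
  strongly_graded_word_rel k%:Z x strongE.
(* From these positions on [p] and [q] coincide, so the two prefixes end at the same vertex. *)
exists (iprefix p i), (iprefix (q : ipath E) j); split.
- exact: iprefix_initial.
- by rewrite !iprefix_tgt -[i]addn0 pq addn0.
- by rewrite !iprefix_len ij fmK.
Qed.

End Necessity.

(** * Sufficiency of (Y1) *)

Section Sufficiency.
Variables (R : nzRingType) (E : digraph).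
Local Notation G := (@lpa_component R E).
Local Notation V v := (lpa_gen_elt R (GVertex v)).
Local Notation X e := (lpa_gen_elt R (GEdge e)).
Local Notation X' e := (lpa_gen_elt R (GGhost e)).
Implicit Types (v : vertex E) (e : edge E).

(** An element x with v x = x inherits a factorization of v, with x absorbed into the right
    factors. *)
Lemma lpa_component_subset_sums a b n :
  (forall v, setprod_sums (G a) (G b) (V v)) ->
  G n `<=` setprod_sums (G a) (G (b + n)).
Proof.
move=> GV; apply: lpa_component_ind => [|x y|v x xn <-].
- exact: setprod_sums0.
- exact: setprod_sumsD.
- by apply: setprod_sums_mulr (GV v) => y yb; exact: lpa_componentM.
Qed.

(** Here v is the sum of the e r(e) e^*, and e and e^* are absorbed into the outer factors of
    r(e). *)
Lemma setprod_sums_vertex_out a b v : regular v ->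
  (forall e, src e = v -> setprod_sums (G (a - 1)) (G (b + 1)) (V (tgt e))) ->
  setprod_sums (G a) (G b) (V v).
Proof.
move=> [v0 vf] GV; rewrite lpa_CK2 //; apply: setprod_sums_sum => e.
rewrite in_fset_set // inE => /GV Ge; rewrite -lpa_tgt_ghost.
apply: (@setprod_sums_mull _ (G (a - 1))) => [x xa|].
  rewrite -(subrK 1 a) addrC; apply: lpa_componentM => //.
  exact: (lpa_component_gen R (GEdge e)).
apply: (@setprod_sums_mulr _ _ (G (b + 1))) Ge => x xb.
rewrite -(addrK 1 b); apply: lpa_componentM => //.
exact: (lpa_component_gen R (GGhost e)).
Qed.

(** From r(e) = e^* s(e) e, with e^* and e absorbed into the outer factors. *)
Lemma setprod_sums_vertex_in a b e :
  setprod_sums (G a) (G b) (V (src e)) ->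
  setprod_sums (G (a - 1)) (G (b + 1)) (V (tgt e)).
Proof.
move=> Ge; rewrite -lpa_CK1 -lpa_src_edge.
apply: (@setprod_sums_mull _ (G a)) => [x xa|].
  rewrite addrC; apply: lpa_componentM => //.
  exact: (lpa_component_gen R (GGhost e)).
apply: (@setprod_sums_mulr _ _ (G b)) Ge => x xb.
apply: lpa_componentM => //; exact: (lpa_component_gen R (GEdge e)).
Qed.

Lemma setprod_sums_vertex v : setprod_sums (G 0) (G 0) (V v).
Proof.
rewrite -lpa_vertex_idem; apply: setprod_sumsM;
  exact: (lpa_component_gen R (GVertex v)).
Qed.

Lemma setprod_sums_path_tgt (b : fpath E) :
  setprod_sums (G (- (fpath_len b)%:Z)) (G (fpath_len b)%:Z) (V (fpath_tgt b)).
Proof.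
case: b => v s ch; rewrite /fpath_len /fpath_tgt /=.
have := setprod_sums_vertex v; rewrite -{1}oppr0 -[0]/(0%N%:Z).
(* The generalized number counts the edges already traversed, and [v] is the vertex reached after
   them. *)
rewrite -[size s]add0n; elim: s v (0%N) ch => [|e s IHs] v n /=.
  by rewrite addn0.
move=> [<- /IHs IH] /setprod_sums_vertex_in Ge.
rewrite addnS -addSn; apply: IH.
by rewrite -addn1 PoszD opprD.
Qed.

Lemma condition_Y1_vertex v : (forall u : vertex E, regular u) ->
  condition_Y1 E -> setprod_sums (G (-1)) (G 1) (V v).
Proof.
move=> regE Y1; apply: contrapT => badv.
pose bad n u := ~ setprod_sums (G (- n.+1%:Z)) (G n.+1%:Z) (V u).
(* Contrapositive of [setprod_sums_vertex_out]: a bad vertex emits an edge to a vertex that is bad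
   one degree further. An edge is also provided at vertices that are not bad, so that the choice
   function is total. *)
have step (nu : nat * vertex E) : exists e, src e = nu.2 /\
    (bad nu.1 nu.2 -> bad nu.1.+1 (tgt e)).
  case: nu => n u /=; apply: contrapT => Ne.
  have [[e0 ue0] _] := regE u.
  have [badu|] := pselect (bad n u); last by move=> Nb; apply: Ne; exists e0.
  apply: badu; apply: setprod_sums_vertex_out => // e ue.
  apply: contrapT => bade; apply: Ne; exists e; split=> // _.
  by rewrite /bad -addn1 PoszD opprD.
have [next nextP] := choice step.
pose vs := fix vs n := if n is m.+1 then tgt (next (m, vs m)) else v.
have pP i : tgt (next (i, vs i)) = src (next (i.+1, vs i.+1)).
  by rewrite (nextP (i.+1, vs i.+1)).1.
have bad_vs n : bad n (vs n).
  by elim: n => [//|n IHn]; exact: (nextP (n, vs n)).2.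
have [a [b [/initial_subpath_tgt /= aE ba ab1]]] := Y1 (IPath pP).
apply: (bad_vs (fpath_len a)); have -> : vs (fpath_len a) = fpath_tgt b.
  by rewrite ba aE (nextP (_, _)).1.
(* The length of [b] is the very degree in which the vertex after [fpath_len a] edges is bad. *)
have <- : fpath_len b = (fpath_len a).+1; last exact: setprod_sums_path_tgt.
by apply/eqP; rewrite -eqz_nat -addn1 PoszD addrC -subr_eq ab1.
Qed.

Lemma condition_Y1_strongly_graded : (forall u : vertex E, regular u) ->
  condition_Y1 E -> strongly_graded G.
Proof.
move=> regE Y1; apply: strongly_graded_unit_steps; first exact: lpa_graded.
- move=> n; rewrite -{2}[n]add0r; apply: lpa_component_subset_sums.
  exact: setprod_sums_vertex.
(* Relation (4) reduces degrees 1 and -1 at [v] to degrees 0 and 0 at the ranges of its edges. *)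
- move=> n; rewrite addrC; apply: lpa_component_subset_sums => v.
  apply: setprod_sums_vertex_out => // e _; rewrite subrr addNr.
  exact: setprod_sums_vertex.
- move=> n; rewrite addrC; apply: lpa_component_subset_sums => v.
  exact: condition_Y1_vertex.
Qed.

End Sufficiency.

(** * The equivalence of the three assertions *)

Theorem theorem1p3 (R : nzRingType) (E : digraph) :
  (strongly_graded (@lpa_component R E) <->
     [/\ row_finite E, forall v : vertex E, ~ is_sink v & condition_Y E]) /\
  (strongly_graded (@lpa_component R E) <->
     [/\ row_finite E, forall v : vertex E, ~ is_sink v & condition_Y1 E]).
Proof.
(* The implications (i) to (ii), (ii) to (iii) and (iii) to (i) are combined into the two
   equivalences. *)
have YY1 : condition_Y E -> condition_Y1 E by apply.
have nec : strongly_graded (@lpa_component R E) ->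
    [/\ row_finite E, forall v : vertex E, ~ is_sink v & condition_Y E].
  move=> strongE; have regE v := strongly_graded_regular v strongE.
  split=> [v|v|]; [exact: (regE v).2 | |];
    last exact: strongly_graded_condition_Y strongE.
  by move=> v0; have [[e ve] _] := regE v; have : set0 e by rewrite -v0.
have suf : row_finite E -> (forall v : vertex E, ~ is_sink v) ->
    condition_Y1 E -> strongly_graded (@lpa_component R E).
  move=> rf ns; apply: condition_Y1_strongly_graded => u; split=> //.
  by apply/set0P/eqP; exact: ns.
split; split=> [/nec|[rf ns Y]] //; try exact: suf (YY1 Y).
- by move=> [rf ns /YY1].
- exact: suf.
Qed.
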